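(* Let $D$ be a finite digraph, possibly with loops but without multiple arcs. Let $M(D)$ be its middle digraph and $S(D)$ its subdivision digraph. Let $v$, $A$, $B$ denote respectively the number of vertices, the number of sinks and the number of sources of $D$. Then $$i(M(D)) = i(S(D)) = 2v - A - B,$$ where $i(\cdot)$ denotes the intersection number of a digraph.
   Context: Digraphs are finite, may have loops, and have no multiple arcs; $V(D)$ and $E(D)$ are the vertex set and arc set. A source is a vertex with no incoming arcs and a sink is a vertex with no outgoing arcs; loops count as both incoming and outgoing arcs, so a vertex with a loop is neither a source nor a sink. Intersection number: given a set $U$ and a family of ordered pairs $(S_x,T_x)$ of subsets of $U$ indexed by the vertices $x$ of a digraph $H$, the digraph $H$ is the intersection digraph of this family if for all vertices $x,y$ (possibly equal) $(x,y)$ is an arc of $H$ iff $S_x\cap T_y\neq\emptyset$. The intersection number $i(H)$ is the minimum size of a set $U$ such that $H$ is the intersection digraph of a family of ordered pairs of subsets of $U$. Line digraph $L(D)$: vertex set $E(D)$, with an arc from $e$ to $f$ iff the arc $e$ ends (in $D$) at the vertex where the arc $f$ starts (so a loop of $D$ gives a loop of $L(D)$). Subdivision digraph $S(D)$: obtained by placing a vertex on every arc of $D$; its vertex set is $V(D)\cup E(D)$ (disjoint union) and for each arc $e=(u,w)$ of $D$ (including loops, $u=w$) it has the arcs $(u,e)$ and $(e,w)$, and no others. Middle digraph $M(D)$: vertex set $V(D)\cup E(D)$, with arc set $E(S(D))\cup E(L(D))$. *)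

(* Defs.v *)
From mathcomp Require Import all_boot.

Set Implicit Arguments.
Unset Strict Implicit.
Unset Printing Implicit Defensive.

(* A finite digraph, loops allowed and without multiple arcs,
   is a relation D : rel V on a finType V: (x, y) is an arc iff D x y. *)

Definition source (V : finType) (D : rel V) (x : V) : bool :=
  [forall y, ~~ D y x].

Definition sink (V : finType) (D : rel V) (x : V) : bool :=
  [forall y, ~~ D x y].

Definition arc (V : finType) (D : rel V) : finType :=
  {p : V * V | D p.1 p.2}.

Definition arc_start (V : finType) (D : rel V) (e : arc D) : V := (val e).1.

Definition arc_end (V : finType) (D : rel V) (e : arc D) : V := (val e).2.

Definition line_digraph (V : finType) (D : rel V) : rel (arc D) :=
  fun e f => arc_end e == arc_start f.

Definition subdivision_digraph (V : finType) (D : rel V) : rel (V + arc D) :=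
  fun x y =>
    match x, y with
    | inl u, inr e => u == arc_start e
    | inr e, inl w => arc_end e == w
    | _, _ => false
    end.

Definition middle_digraph (V : finType) (D : rel V) : rel (V + arc D) :=
  fun x y =>
    subdivision_digraph x y ||
    match x, y with
    | inr e, inr f => line_digraph e f
    | _, _ => false
    end.

Definition is_intersection_digraph (W U : finType) (H : rel W)
    (S T : W -> {set U}) : Prop :=
  forall x y, H x y = (S x :&: T y != set0).

(* The boolean form of "H is an intersection digraph over a set of size k";
   restricting U to 'I_k loses nothing, see has_intersection_repP. *)
Definition has_intersection_rep (W : finType) (H : rel W) (k : nat) : bool :=
  [exists S : {ffun W -> {set 'I_k}}, exists T : {ffun W -> {set 'I_k}},
     [forall x, forall y, H x y == (S x :&: T y != set0)]].

Lemma has_intersection_repP (W : finType) (H : rel W) (k : nat) :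
  has_intersection_rep H k <->
  exists (U : finType) (S T : W -> {set U}),
    #|U| = k /\ is_intersection_digraph H S T.
Proof.
split=> [/existsP[S /existsP[T /forallP HST]]|[U [S [T [<- HST]]]]].
  exists 'I_k, S, T; split; first exact: card_ord.
  by move=> x y; apply/eqP; move/forallP: (HST x); apply.
apply/existsP; exists [ffun x => enum_rank @: S x].
apply/existsP; exists [ffun x => enum_rank @: T x].
apply/forallP=> x; apply/forallP=> y; rewrite !ffunE HST.
rewrite -imsetI; last by move=> a b _ _; apply: enum_rank_inj.
by rewrite imset_eq0.
Qed.

Lemma intersection_rep_exists (W : finType) (H : rel W) :
  exists k, has_intersection_rep H k.
Proof.
exists #|{: W * W}|; apply/has_intersection_repP.
exists (W * W)%type, (fun x => [set p | (p.1 == x) && H p.1 p.2]),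
  (fun y => [set p | p.2 == y]); split=> // x y.
apply/idP/set0Pn=> [Hxy|[p]]; first by exists (x, y); rewrite !inE /= !eqxx Hxy.
by rewrite !inE => /andP[/andP[/eqP<- Hp] /eqP<-].
Qed.

Definition intersection_number (W : finType) (H : rel W) : nat :=
  ex_minn (intersection_rep_exists H).

Lemma intersection_numberP (W : finType) (H : rel W) :
  (exists (U : finType) (S T : W -> {set U}),
     #|U| = intersection_number H /\ is_intersection_digraph H S T) /\
  (forall (U : finType) (S T : W -> {set U}),
     is_intersection_digraph H S T -> intersection_number H <= #|U|).
Proof.
rewrite /intersection_number; case: ex_minnP => m Hm min_m.
split; first exact/has_intersection_repP.
move=> U S T HST; apply: min_m; apply/has_intersection_repP.
by exists U, S, T.
Qed.

(* Main.v *)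
(** An element [p] of a set realising [H] as an intersection digraph covers the
    arcs [(x, y)] with [p \in S x] and [p \in T y], which form a complete
    bipartite piece of [H].  Hence [H] needs at least as many elements as it
    has arcs no two of which lie in a common such piece.  In [S(D)] and [M(D)],
    take one arc [(u, e)] for each non-sink [u] and one arc [(e, w)] for each
    non-source [w]: no two are compatible because [V(D)] spans no arc and an
    arc of [D] has one start and one end.  Conversely, the pieces
    [u -> out(u)] and [in(w) -> w], the former enlarged to
    [in(u) + u -> out(u)] for [M(D)], cover all arcs. *)

Require Import Defs.
From mathcomp Require Import all_boot.

Set Implicit Arguments.
Unset Strict Implicit.
Unset Printing Implicit Defensive.

Lemma fooling_set_leq_intersection_number (W I : finType) (H : rel W)
    (x y : I -> W) :
  (forall i, H (x i) (y i)) ->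
  (forall i j, H (x i) (y j) -> H (x j) (y i) -> i = j) ->
  #|I| <= intersection_number H.
Proof.
move=> Hxy incompat; have [[U [S [T [<- HST]]]] _] := intersection_numberP H.
have /fin_all_exists[p Sp] i : exists p, p \in S (x i) :&: T (y i).
  by apply/set0Pn; rewrite -HST.
apply: (@leq_card _ _ p) => i j eq_p.
have /setIP[Si Ti] := Sp i; have /setIP[Sj Tj] := Sp j.
by apply: incompat; rewrite HST; apply/set0Pn; exists (p i);
  rewrite inE ?Si ?Ti eq_p ?Sj ?Tj.
Qed.

(** Indexes both the pieces of the cover and the pairwise incompatible arcs, so the two bounds
    meet. *)
Definition cover_index (V : finType) (D : rel V) : finType :=
  ({u | ~~ sink D u} + {w | ~~ source D w})%type.

Lemma card_cover_index (V : finType) (D : rel V) :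
  #|cover_index D| =
    2 * #|V| - #|[set x : V | sink D x]| - #|[set x : V | source D x]|.
Proof.
rewrite card_sum !card_sig mul2n -addnn.
have cardN (P : pred V) : #|[pred u | ~~ P u]| = #|V| - #|[set u | P u]|.
  by rewrite cardsE -(cardC P) addKn; apply: eq_card.
(* Truncated subtraction is harmless: each subtrahend is at most [#|V|]. *)
rewrite !cardN addnBAC ?max_card // addnBA ?max_card //.
by rewrite subnAC.
Qed.

(* The flag [b] tells whether the arcs of the line digraph are present:
   [b = false] gives [S(D)] and [b = true] gives [M(D)]. *)
Lemma intersection_number_subdivision_or_middle (V : finType) (D : rel V)
    (b : bool) (H : rel (V + Defs.arc D)) :
  (forall u w, H (inl u) (inl w) = false) ->
  (forall u e, H (inl u) (inr e) = (u == arc_start e)) ->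
  (forall e w, H (inr e) (inl w) = (arc_end e == w)) ->
  (forall e f, H (inr e) (inr f) = b && line_digraph e f) ->
  intersection_number H = #|cover_index D|.
Proof.
move=> Hvv Hve Hev Hee; apply/eqP; rewrite eqn_leq; apply/andP; split.
  have [_ min_H] := intersection_numberP H.
  (* [inl u] stands for the piece into out(u), [inr w] for in(w) -> w; [b] adds in(u) to the tails
     of the former. *)
  pose S (x : V + Defs.arc D) := [set k : cover_index D |
    match x, k with
    | inl u, inl u' => u == val u'
    | inl _, inr _ => false
    | inr e, inl u => b && (arc_end e == val u)
    | inr e, inr w => arc_end e == val w
    end].
  pose T (y : V + Defs.arc D) := [set k : cover_index D |
    match y, k with
    | inl w, inr w' => w == val w'
    | inr e, inl u => arc_start e == val u
    | _, _ => false
    end].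
  have start_nsink (e : Defs.arc D) : ~~ sink D (arc_start e).
    by apply/forallPn; exists (arc_end e); rewrite negbK; exact: (valP e).
  have end_nsource (e : Defs.arc D) : ~~ source D (arc_end e).
    by apply/forallPn; exists (arc_start e); rewrite negbK; exact: (valP e).
  apply: (min_H _ S T) => -[u|e] [w|f].
  - rewrite Hvv; apply/esym/set0Pn => -[[k|k]]; by rewrite !inE ?andbF.
  - rewrite Hve; apply/eqP/set0Pn => [->|[[k|k]]]; last by rewrite !inE.
      by exists (inl (Sub (arc_start f) (start_nsink f))); rewrite !inE /= eqxx.
    by rewrite !inE => /andP[/eqP-> /eqP->].
  - rewrite Hev; apply/eqP/set0Pn => [<-|[[k|k]]]; first 1 last.
    + by rewrite !inE andbF.
    + by rewrite !inE => /andP[/eqP-> /eqP->].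
    by exists (inr (Sub (arc_end e) (end_nsource e))); rewrite !inE /= eqxx.
  rewrite Hee; apply/andP/set0Pn => [[b1 /eqP ef]|[[k|k]]]; last first.
  - by rewrite !inE andbF.
  - by rewrite !inE => /andP[/andP[-> /eqP ek] /eqP fk]; rewrite /line_digraph ek fk.
  (* The piece at the vertex where [e] ends and [f] starts. *)
  exists (inl (Sub (arc_start f) (start_nsink f))).
  by rewrite !inE /= b1 ef !eqxx.
have /fin_all_exists[out outE] (u : {u | ~~ sink D u}) :
    exists e : Defs.arc D, arc_start e = val u.
  have /forallPn[w] := valP u; rewrite negbK => Duw.
  by exists (exist (fun p => D p.1 p.2) (val u, w) Duw).
have /fin_all_exists[inn innE] (w : {w | ~~ source D w}) :
    exists e : Defs.arc D, arc_end e = val w.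
  have /forallPn[u] := valP w; rewrite negbK => Duw.
  by exists (exist (fun p => D p.1 p.2) (u, val w) Duw).
pose x (k : cover_index D) : V + Defs.arc D :=
  match k with inl u => inl (val u) | inr w => inr (inn w) end.
pose y (k : cover_index D) : V + Defs.arc D :=
  match k with inl u => inr (out u) | inr w => inl (val w) end.
apply: (@fooling_set_leq_intersection_number _ _ H x y) => [[u|w]|].
- by rewrite Hve outE.
- by rewrite Hev innE.
(* For indices of different kinds, one crossing arc would join two vertices of [V], which [Hvv]
   forbids for either [b]. *)
move=> [u|w] [u'|w'] /=; rewrite ?Hvv // ?Hve ?Hev ?outE ?innE.
  by move/eqP/val_inj->.
by move/eqP/val_inj->.
Qed.

Theorem theorem1 (V : finType) (D : rel V) :
  intersection_number (@middle_digraph V D) =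
    intersection_number (@subdivision_digraph V D) /\
  intersection_number (@subdivision_digraph V D) =
    2 * #|V| - #|[set x : V | sink D x]| - #|[set x : V | source D x]|.
Proof.
have subdivisionE :=
  @intersection_number_subdivision_or_middle V D false (@subdivision_digraph V D).
have middleE :=
  @intersection_number_subdivision_or_middle V D true (@middle_digraph V D).
rewrite middleE ?subdivisionE ?card_cover_index //.
- by move=> u e; apply: orbF.
- by move=> e w; apply: orbF.
Qed.
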